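(* For every involutive category $(\mathbf{D},K,k)\in\mathbf{ICat}$, there is a $2$-adjunction $$(-)\times(\mathbf{D},K,k)\;:\;\mathbf{ICat}\;\rightleftarrows\;\mathbf{ICat}\;:\;(-)^{(\mathbf{D},K,k)},$$ with $(-)\times(\mathbf{D},K,k)$ left adjoint to $(-)^{(\mathbf{D},K,k)}$.
   Context: An involutive category $(\mathbf{C},J,j)$ is a category $\mathbf{C}$ with an endofunctor $J:\mathbf{C}\to\mathbf{C}$ and a natural isomorphism $j:\mathrm{Id}_{\mathbf{C}}\to J^2$ such that $jJ=Jj:J\to J^3$. An involutive functor $(F,\nu):(\mathbf{C},J,j)\to(\mathbf{C}',J',j')$ is a functor $F$ with a natural transformation $\nu:FJ\to J'F$ such that $(J'\nu)(\nu J)(Fj)=j'F$ ($\nu$ is then automatically an isomorphism). Composition is $(F',\nu')(F,\nu)=(F'F,(\nu'F)(F'\nu))$, identities are $(\mathrm{Id}_{\mathbf{C}},\mathrm{id}_J)$. An involutive natural transformation $\zeta:(F,\nu)\to(G,\chi)$ is a natural transformation $\zeta:F\to G$ with $\chi(\zeta J)=(J'\zeta)\nu$. These form the $2$-category $\mathbf{ICat}$. Product $2$-functor: $(\mathbf{C},J,j)\times(\mathbf{D},K,k):=(\mathbf{C}\times\mathbf{D},J\times K,j\times k)$ on objects, $(F,\nu)\times(G,\chi):=(F\times G,\nu\times\chi)$ on involutive functors and $\zeta\times\xi$ on involutive natural transformations. $(-)\times(\mathbf{D},K,k)$ is obtained by fixing the second entry. Exponential $2$-functor: for functors $G:\mathbf{D}'\to\mathbf{D}$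 and $F:\mathbf{C}\to\mathbf{C}'$ let $F^G:\mathbf{C}^{\mathbf{D}}\to\mathbf{C}'^{\mathbf{D}'}$ be $X\mapsto FXG$, $\alpha\mapsto F\alpha G$; for natural transformations $\xi:G\to G'$ and $\zeta:F\to F'$ let $\zeta^\xi:F^G\to F'^{G'}$ have components $(\zeta^\xi)_X=(F'X\xi)(\zeta XG)=(\zeta XG')(FX\xi)$. Then $(\mathbf{C},J,j)^{(\mathbf{D},K,k)}:=(\mathbf{C}^{\mathbf{D}},J^K,j^k)$, where $\mathbf{C}^{\mathbf{D}}$ is the functor category; $(F,\nu)^{(G,\chi)}:=(F^G,\nu^{\chi^{-1}})$ on involutive functors; $\zeta^\xi$ on involutive natural transformations. This is a $2$-functor $\mathbf{ICat}^{\mathrm{op}}\times\mathbf{ICat}\to\mathbf{ICat}$ (with $1$-cells reversed in $\mathbf{ICat}^{\mathrm{op}}$), and $(-)^{(\mathbf{D},K,k)}$ is obtained by fixing the exponent (with identity $1$- and $2$-cells in the exponent). *)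

(* Defs.v *)
From Stdlib Require Import FunctionalExtensionality ProofIrrelevance JMeq.

Set Implicit Arguments.
Unset Strict Implicit.

Declare Scope cat_scope.
Delimit Scope cat_scope with cat.
Local Open Scope cat_scope.

(* Equality of objects and of morphisms is Leibniz equality.  The functor
   categories below force objects and morphisms into one and the same universe,
   so a [Category] is a category that is small relative to that universe. *)
Record Category := {
  ob :> Type;
  hom : ob -> ob -> Type;
  idm : forall x, hom x x;
  comp : forall x y z, hom y z -> hom x y -> hom x z;
  comp_assoc : forall w x y z (h : hom y z) (g : hom x y) (f : hom w x),
    comp (comp h g) f = comp h (comp g f);
  comp_id_l : forall x y (f : hom x y), comp (idm y) f = f;
  comp_id_r : forall x y (f : hom x y), comp f (idm x) = f
}.
Arguments hom {_} _ _.
Arguments idm {_} _.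
Arguments comp {_ _ _ _} _ _.

Notation "g ∘ f" := (comp g f) (at level 40, left associativity) : cat_scope.

Record Functor (C D : Category) := {
  fob :> C -> D;
  fmap : forall x y : C, hom x y -> hom (fob x) (fob y);
  fmap_id : forall x, fmap (idm x) = idm (fob x);
  fmap_comp : forall x y z (g : hom y z) (f : hom x y),
    fmap (g ∘ f) = fmap g ∘ fmap f
}.
Arguments fmap {_ _} _ {_ _} _.

Record Nat (C D : Category) (F G : Functor C D) := {
  nat_comp :> forall x : C, hom (F x) (G x);
  nat_natural : forall (x y : C) (f : hom x y),
    nat_comp y ∘ fmap F f = fmap G f ∘ nat_comp x
}.

Record NatIso (C D : Category) (F G : Functor C D) := {
  iso_nat :> Nat F G;
  iso_inv : forall x : C, hom (G x) (F x);
  iso_inv_l : forall x, iso_inv x ∘ iso_nat x = idm (F x);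
  iso_inv_r : forall x, iso_nat x ∘ iso_inv x = idm (G x)
}.

Lemma inverse_natural (C D : Category) (F G : Functor C D) (a : Nat F G)
  (b : forall x : C, hom (G x) (F x)) :
  (forall x, b x ∘ a x = idm (F x)) -> (forall x, a x ∘ b x = idm (G x)) ->
  forall (x y : C) (f : hom x y), b y ∘ fmap G f = fmap F f ∘ b x.
Proof.
intros l r x y f.
transitivity (b y ∘ (fmap G f ∘ a x) ∘ b x).
- rewrite !comp_assoc, r, comp_id_r; reflexivity.
- rewrite <- nat_natural, <- comp_assoc, l, comp_id_l; reflexivity.
Qed.

Lemma iso_inv_natural (C D : Category) (F G : Functor C D) (a : NatIso F G)
  (x y : C) (f : hom x y) :
  iso_inv a y ∘ fmap G f = fmap F f ∘ iso_inv a x.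
Proof. exact (inverse_natural (iso_inv_l a) (iso_inv_r a) f). Qed.

Lemma nat_ext (C D : Category) (F G : Functor C D) (a b : Nat F G) :
  (forall x, a x = b x) -> a = b.
Proof.
destruct a as [a ha], b as [b hb]; cbn; intros e.
assert (a = b) by (apply functional_extensionality_dep; exact e); subst b.
f_equal; apply proof_irrelevance.
Qed.

Lemma functor_ext (C D : Category) (F G : Functor C D) :
  (forall x, F x = G x) ->
  (forall x y (f : hom x y), JMeq (fmap F f) (fmap G f)) -> F = G.
Proof.
destruct F as [o m i c], G as [o' m' i' c']; cbn; intros e em.
assert (o = o') by (apply functional_extensionality; exact e); subst o'.
assert (m = m').
{ do 3 (apply functional_extensionality_dep; intro); apply JMeq_eq, em. }
subst m'; f_equal; apply proof_irrelevance.
Qed.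

Definition id_fun (C : Category) : Functor C C.
Proof. exists (fun x => x) (fun x y f => f); abstract reflexivity. Defined.

Definition comp_fun (C D E : Category) (G : Functor D E) (F : Functor C D) :
  Functor C E.
Proof.
exists (fun x => G (F x)) (fun x y f => fmap G (fmap F f));
  abstract (intros; rewrite ?fmap_id, ?fmap_comp; reflexivity).
Defined.
Notation "G ∘F F" := (comp_fun G F) (at level 40, left associativity) : cat_scope.

Definition const_fun (C D : Category) (d : D) : Functor C D.
Proof.
exists (fun _ => d) (fun _ _ _ => idm d);
  abstract (intros; rewrite ?comp_id_l; reflexivity).
Defined.

Definition prod_cat (C D : Category) : Category.
Proof.
exists (C * D)%type
  (fun p q => (hom (fst p) (fst q) * hom (snd p) (snd q))%type)
  (fun p => (idm (fst p), idm (snd p)))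
  (fun p q r g f => (fst g ∘ fst f, snd g ∘ snd f)); cbn.
- abstract (intros; rewrite !comp_assoc; reflexivity).
- abstract (intros ? ? []; cbn; rewrite !comp_id_l; reflexivity).
- abstract (intros ? ? []; cbn; rewrite !comp_id_r; reflexivity).
Defined.

Definition pair_fun (A C D : Category) (F : Functor A C) (G : Functor A D) :
  Functor A (prod_cat C D).
Proof.
exists (fun x => (F x, G x) : prod_cat C D)
       (fun x y f => (fmap F f, fmap G f));
  abstract (intros; cbn; rewrite ?fmap_id, ?fmap_comp; reflexivity).
Defined.

Definition prod_fun (C C' D D' : Category) (F : Functor C C') (G : Functor D D') :
  Functor (prod_cat C D) (prod_cat C' D').
Proof.
exists (fun p : prod_cat C D => (F (fst p), G (snd p)) : prod_cat C' D')
       (fun p q f => (fmap F (fst f), fmap G (snd f)));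
  abstract (intros; cbn; rewrite ?fmap_id, ?fmap_comp; reflexivity).
Defined.

Definition assoc_fun (A B C : Category) :
  Functor (prod_cat (prod_cat A B) C) (prod_cat A (prod_cat B C)).
Proof.
exists (fun p : prod_cat (prod_cat A B) C =>
          (fst (fst p), (snd (fst p), snd p)) : prod_cat A (prod_cat B C))
       (fun p q f => (fst (fst f), (snd (fst f), snd f))); abstract reflexivity.
Defined.

(* [fun_cat D C] is the functor category C^D. *)
Definition fun_cat (D C : Category) : Category.
Proof.
unshelve eexists (Functor D C) (@Nat D C) _ _.
- intros F; exists (fun x => idm (F x)).
  abstract (intros; rewrite comp_id_l, comp_id_r; reflexivity).
- intros F G H b a; exists (fun x => b x ∘ a x).
  abstract (intros; rewrite comp_assoc, nat_natural, <- comp_assoc, nat_natural;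
            apply comp_assoc).
- abstract (intros; apply nat_ext; intros; cbn; apply comp_assoc).
- abstract (intros; apply nat_ext; intros; cbn; apply comp_id_l).
- abstract (intros; apply nat_ext; intros; cbn; apply comp_id_r).
Defined.

(* Strict 2-categories are presented as categories enriched in the cartesian
   closed category of categories: every axiom is a Leibniz equality of functors
   between hom-categories, so it covers 1-cells and 2-cells at once. *)
Record TwoCategory := {
  cell0 :> Type;
  Hom : cell0 -> cell0 -> Category;
  id1 : forall A, Hom A A;
  comp2 : forall A B C, Functor (prod_cat (Hom B C) (Hom A B)) (Hom A C);
  comp2_assoc : forall A B C D,
    comp2 A B D ∘F prod_fun (comp2 B C D) (id_fun (Hom A B)) =
    comp2 A C D ∘F prod_fun (id_fun (Hom C D)) (comp2 A B C) ∘F assoc_fun _ _ _;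
  comp2_id_l : forall A B,
    comp2 A B B ∘F pair_fun (const_fun _ (id1 B)) (id_fun (Hom A B)) = id_fun _;
  comp2_id_r : forall A B,
    comp2 A A B ∘F pair_fun (id_fun (Hom A B)) (const_fun _ (id1 A)) = id_fun _
}.
Arguments Hom {_} _ _.
Arguments id1 {_} _.
Arguments comp2 {_} _ _ _.

Definition comp1 (X : TwoCategory) (A B C : X) (g : Hom B C) (f : Hom A B) :
  Hom A C := comp2 A B C (g, f).

Definition postcomp (X : TwoCategory) (A B C : X) (g : Hom B C) :
  Functor (Hom A B) (Hom A C) :=
  comp2 A B C ∘F pair_fun (const_fun _ g) (id_fun _).

Definition precomp (X : TwoCategory) (A B C : X) (f : Hom A B) :
  Functor (Hom B C) (Hom A C) :=
  comp2 A B C ∘F pair_fun (id_fun _) (const_fun _ f).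

Record TwoFunctor (X Y : TwoCategory) := {
  tf0 :> X -> Y;
  tf1 : forall A B : X, Functor (Hom A B) (Hom (tf0 A) (tf0 B));
  tf_id : forall A, tf1 A A (id1 A) = id1 (tf0 A);
  tf_comp : forall A B C : X,
    tf1 A C ∘F comp2 A B C =
    comp2 (tf0 A) (tf0 B) (tf0 C) ∘F prod_fun (tf1 B C) (tf1 A B)
}.
Arguments tf1 {_ _} _ _ _.

Definition id_tf (X : TwoCategory) : TwoFunctor X X.
Proof.
exists (fun A => A) (fun A B => id_fun (Hom A B)).
- abstract reflexivity.
- abstract (intros; apply functor_ext; [ intros [] | intros [] [] [] ]; reflexivity).
Defined.

Lemma comp_fun_assoc (A B C D : Category) (H : Functor C D) (G : Functor B C)
  (F : Functor A B) : H ∘F G ∘F F = H ∘F (G ∘F F).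
Proof. apply functor_ext; reflexivity. Qed.

Definition comp_tf (X Y Z : TwoCategory) (G : TwoFunctor Y Z) (F : TwoFunctor X Y) :
  TwoFunctor X Z.
Proof.
exists (fun A => G (F A)) (fun A B => tf1 G (F A) (F B) ∘F tf1 F A B).
- abstract (intros; cbn; rewrite !tf_id; reflexivity).
- abstract (intros A B C; rewrite comp_fun_assoc, tf_comp, <- comp_fun_assoc,
              tf_comp, comp_fun_assoc; apply functor_ext; reflexivity).
Defined.

Record TwoNat (X Y : TwoCategory) (F G : TwoFunctor X Y) := {
  tn_comp :> forall A : X, Hom (F A) (G A);
  tn_natural : forall A B : X,
    postcomp (F A) (tn_comp B) ∘F tf1 F A B =
    precomp (G B) (tn_comp A) ∘F tf1 G A B
}.

(* [TwoAdjunction L R]: L is left 2-adjoint to R. *)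
Record TwoAdjunction (X Y : TwoCategory) (L : TwoFunctor X Y) (R : TwoFunctor Y X) := {
  adj_unit : TwoNat (id_tf X) (comp_tf R L);
  adj_counit : TwoNat (comp_tf L R) (id_tf Y);
  adj_triangle_l : forall A : X,
    comp1 (adj_counit (L A)) (tf1 L _ _ (adj_unit A)) = id1 (L A);
  adj_triangle_r : forall B : Y,
    comp1 (tf1 R _ _ (adj_counit B)) (adj_unit (R B)) = id1 (R B)
}.

Record ICategory := {
  icat :> Category;
  iJ : Functor icat icat;
  ij : NatIso (id_fun icat) (iJ ∘F iJ);
  ij_J : forall x : icat, ij (iJ x) = fmap iJ (ij x)
}.
Arguments iJ : clear implicits.
Arguments ij : clear implicits.

Record IFunctor (C D : ICategory) := {
  ifun :> Functor C D;
  inu : Nat (ifun ∘F iJ C) (iJ D ∘F ifun);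
  inu_ij : forall x : C,
    fmap (iJ D) (inu x) ∘ inu (iJ C x) ∘ fmap ifun (ij C x) = ij D (ifun x)
}.
Arguments inu {_ _} _.

Record INat (C D : ICategory) (F G : IFunctor C D) := {
  inat :> Nat F G;
  inat_inu : forall x : C,
    inu G x ∘ inat (iJ C x) = fmap (iJ D) (inat x) ∘ inu F x
}.

Lemma inat_ext (C D : ICategory) (F G : IFunctor C D) (a b : INat F G) :
  (forall x, a x = b x) -> a = b.
Proof.
destruct a as [a ha], b as [b hb]; cbn; intros e.
assert (a = b) by (apply nat_ext; exact e); subst b.
f_equal; apply proof_irrelevance.
Qed.

Lemma ifunctor_ext (C D : ICategory) (F G : IFunctor C D) :
  (forall x, F x = G x) ->
  (forall x y (f : hom x y), JMeq (fmap F f) (fmap G f)) ->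
  (forall x, JMeq (inu F x) (inu G x)) -> F = G.
Proof.
destruct F as [F n h], G as [G n' h']; cbn; intros e em en.
assert (F = G) by (apply functor_ext; assumption); subst G.
assert (n = n') by (apply nat_ext; intros; apply JMeq_eq, en); subst n'.
f_equal; apply proof_irrelevance.
Qed.

Lemma inat_JMeq (C D : ICategory) (F G F' G' : IFunctor C D)
  (a : INat F G) (b : INat F' G') :
  F = F' -> G = G' -> (forall x, JMeq (a x) (b x)) -> JMeq a b.
Proof.
intros -> -> e.
assert (a = b) by (apply inat_ext; intros; apply JMeq_eq, e); subst b.
reflexivity.
Qed.

Lemma nat_JMeq (C D : Category) (F G F' G' : Functor C D)
  (a : Nat F G) (b : Nat F' G') :
  F = F' -> G = G' -> (forall x, JMeq (a x) (b x)) -> JMeq a b.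
Proof.
intros -> -> e.
assert (a = b) by (apply nat_ext; intros; apply JMeq_eq, e); subst b.
reflexivity.
Qed.

(* Rewriting with an equation stated through [comp_fun] and [id_fun], whose
   values have first to be unfolded. *)
Ltac rw t := let e := fresh in pose proof t as e; cbn in e; rewrite e; clear e.
Ltac rwb t := let e := fresh in pose proof t as e; cbn in e; rewrite <- e; clear e.

Lemma comp_square (C : Category) (w x y z : C)
  (g : hom y z) (f : hom x y) (g' : hom w z) (f' : hom x w) :
  g ∘ f = g' ∘ f' -> forall v (h : hom v x), g ∘ (f ∘ h) = g' ∘ (f' ∘ h).
Proof. intros e v h; rewrite <- !comp_assoc, e; reflexivity. Qed.

Lemma comp_cancel (C : Category) (x y : C) (g : hom y x) (f : hom x y) :
  g ∘ f = idm x -> forall v (h : hom v x), g ∘ (f ∘ h) = h.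
Proof. intros e v h; rewrite <- comp_assoc, e; apply comp_id_l. Qed.

Lemma fmap_square (C D : Category) (F : Functor C D) (w x y z : C)
  (g : hom y z) (f : hom x y) (g' : hom w z) (f' : hom x w) :
  g ∘ f = g' ∘ f' -> fmap F g ∘ fmap F f = fmap F g' ∘ fmap F f'.
Proof. intros e; rewrite <- !fmap_comp, e; reflexivity. Qed.

(* ν is not assumed invertible in [IFunctor]: invertibility follows from
   [inu_ij], and this is the resulting formula for the inverse ν⁻¹ : J'F -> FJ. *)
Definition inu_inv_comp (C D : ICategory) (F : IFunctor C D) (x : C) :
  hom (iJ D (F x)) (F (iJ C x)) :=
  iso_inv (ij D) (F (iJ C x))
    ∘ fmap (iJ D) (inu F (iJ C x) ∘ fmap F (ij C x)).

Lemma inu_inv_l (C D : ICategory) (F : IFunctor C D) (x : C) :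
  inu_inv_comp F x ∘ inu F x = idm (F (iJ C x)).
Proof.
unfold inu_inv_comp; cbn; rewrite fmap_comp, !comp_assoc.
rwb (nat_natural (inu F) (ij C x)); rwb (ij_J x).
rewrite <- (comp_assoc (fmap _ _)); rw (inu_ij F (iJ C x)).
apply (iso_inv_l (ij D)).
Qed.


Lemma inu_inv_r (C D : ICategory) (F : IFunctor C D) (x : C) :
  inu F x ∘ inu_inv_comp F x = idm (iJ D (F x)).
Proof.
unfold inu_inv_comp; cbn; rewrite <- comp_assoc.
rwb (iso_inv_natural (ij D) (inu F x)).
rewrite comp_assoc, <- fmap_comp, <- comp_assoc; rw (inu_ij F x).
rwb (ij_J (F x)); apply (iso_inv_l (ij D)).
Qed.

Definition inu_inv (C D : ICategory) (F : IFunctor C D) :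
  Nat (iJ D ∘F F) (F ∘F iJ C).
Proof.
exists (inu_inv_comp F).
abstract exact (inverse_natural (a := inu F) (@inu_inv_l C D F) (@inu_inv_r C D F)).
Defined.

Lemma inu_inv_ij (C D : ICategory) (F : IFunctor C D) (x : C) :
  inu_inv F (iJ C x) ∘ (fmap (iJ D) (inu_inv F x) ∘ ij D (F x)) = fmap F (ij C x).
Proof.
cbn; rwb (inu_ij F x); rewrite !comp_assoc.
rewrite <- (comp_assoc (fmap (iJ D) _) (fmap (iJ D) _)), <- fmap_comp.
rw (inu_inv_l F x); rewrite fmap_id, comp_id_l.
rw (comp_cancel (inu_inv_l F (iJ C x))); reflexivity.
Qed.

Lemma inat_inu_inv (C D : ICategory) (F G : IFunctor C D) (a : INat F G) (x : C) :
  a (iJ C x) ∘ inu_inv F x = inu_inv G x ∘ fmap (iJ D) (a x).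
Proof.
cbn; transitivity (inu_inv_comp G x ∘ (inu G x ∘ (a (iJ C x) ∘ inu_inv_comp F x))).
- rw (comp_cancel (inu_inv_l G x)); reflexivity.
- rw (comp_square (inat_inu a x)); rw (inu_inv_r F x); rewrite comp_id_r; reflexivity.
Qed.

Definition id_ifun (C : ICategory) : IFunctor C C.
Proof.
unshelve eexists (id_fun C) _.
- unshelve eexists; [exact (fun x => idm (iJ C x)) |].
  abstract (intros; cbn; rewrite comp_id_l, comp_id_r; reflexivity).
- abstract (intros; cbn; rewrite fmap_id, !comp_id_l; reflexivity).
Defined.

Lemma inu_inv_id (C : ICategory) (x : C) : inu_inv (id_ifun C) x = idm (iJ C x).
Proof. etransitivity; [symmetry; apply comp_id_r | apply (inu_inv_l (id_ifun C))]. Qed.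

Definition comp_ifun (C D E : ICategory) (G : IFunctor D E) (F : IFunctor C D) :
  IFunctor C E.
Proof.
unshelve eexists (G ∘F F) _.
- unshelve eexists; [exact (fun x => inu G (F x) ∘ fmap G (inu F x)) |].
  abstract (intros x y f; cbn; rewrite comp_assoc;
            rw (fmap_square G (nat_natural (inu F) f));
            rw (comp_square (nat_natural (inu G) (fmap F f)));
            reflexivity).
- abstract (intros x; cbn; rwb (inu_ij G (F x)); rwb (inu_ij F x);
            rewrite !fmap_comp, !comp_assoc;
            rw (comp_square (nat_natural (inu G) (inu F x))); reflexivity).
Defined.

Definition inat_id (C D : ICategory) (F : IFunctor C D) : INat F F.
Proof.
exists (idm (F : fun_cat C D)).
abstract (intros; cbn; rewrite fmap_id, comp_id_l, comp_id_r; reflexivity).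
Defined.

Definition inat_vcomp (C D : ICategory) (F G H : IFunctor C D)
  (b : INat G H) (a : INat F G) : INat F H.
Proof.
exists (comp (c := fun_cat C D) b a).
abstract (intros x; cbn; rewrite fmap_comp, !comp_assoc; rwb (inat_inu a x);
          rw (comp_square (inat_inu b x)); reflexivity).
Defined.

Definition icat_hom (C D : ICategory) : Category.
Proof.
exists (IFunctor C D) (@INat C D) (@inat_id C D) (@inat_vcomp C D).
- abstract (intros; apply inat_ext; intros; cbn; apply comp_assoc).
- abstract (intros; apply inat_ext; intros; cbn; apply comp_id_l).
- abstract (intros; apply inat_ext; intros; cbn; apply comp_id_r).
Defined.

Definition inat_hcomp (C D E : ICategory) (G G' : IFunctor D E) (F F' : IFunctor C D)
  (b : INat G G') (a : INat F F') : INat (comp_ifun G F) (comp_ifun G' F').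
Proof.
unshelve eexists.
- unshelve eexists; [exact (fun x => b (F' x) ∘ fmap G (a x)) |].
  abstract (intros x y f; cbn; rewrite comp_assoc, (fmap_square G (nat_natural a f)),
              (comp_square (nat_natural b _)); reflexivity).
- abstract (intros x; cbn; rewrite fmap_comp, !comp_assoc;
            rwb (comp_square (nat_natural b (inu F' x)));
            rewrite <- (fmap_comp G); rw (inat_inu a x); rewrite fmap_comp;
            rw (comp_square (inat_inu b (F' x)));
            rwb (comp_square (nat_natural (inu G) (a x))); reflexivity).
Defined.

Definition icat_comp (C D E : ICategory) :
  Functor (prod_cat (icat_hom D E) (icat_hom C D)) (icat_hom C E).
Proof.
exists (fun p : prod_cat (icat_hom D E) (icat_hom C D) =>
          comp_ifun (fst p) (snd p) : icat_hom C E)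
       (fun p q f => inat_hcomp (fst f) (snd f)).
- abstract (intros; apply inat_ext; intros; cbn; rewrite fmap_id, comp_id_l;
            reflexivity).
- abstract (intros; apply inat_ext; intros; cbn;
            rewrite fmap_comp, !comp_assoc, (comp_square (nat_natural (fst f) _));
            reflexivity).
Defined.

Lemma icat_functor_ext (A : Category) (C D : ICategory)
  (P Q : Functor A (icat_hom C D)) :
  (forall x, P x = Q x) ->
  (forall x y (f : hom x y) (c : C), JMeq ((fmap P f : INat _ _) c)
                                          ((fmap Q f : INat _ _) c)) ->
  P = Q.
Proof.
intros e em; apply functor_ext; [exact e | intros x y f].
apply inat_JMeq; [apply e | apply e | apply em].
Qed.

Definition ICat : TwoCategory.
Proof.
exists ICategory icat_hom (fun C => id_ifun C : icat_hom C C) icat_comp.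
- abstract (intros; apply icat_functor_ext; [intros; apply ifunctor_ext |];
            intros; cbn; rewrite ?fmap_comp, ?comp_assoc; reflexivity).
- abstract (intros; apply icat_functor_ext; [intros; apply ifunctor_ext |];
            intros; cbn; rewrite ?comp_id_l; reflexivity).
- abstract (intros; apply icat_functor_ext; [intros; apply ifunctor_ext |];
            intros; cbn; rewrite ?fmap_id, ?comp_id_r; reflexivity).
Defined.

Definition prod_nat (C C' D D' : Category) (F F' : Functor C C') (G G' : Functor D D')
  (a : Nat F F') (b : Nat G G') : Nat (prod_fun F G) (prod_fun F' G').
Proof.
unshelve eexists; [exact (fun p : prod_cat C D => (a (fst p), b (snd p))) |].
abstract (intros; cbn; rewrite !nat_natural; reflexivity).
Defined.

Definition prod_icat (C D : ICategory) : ICategory.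
Proof.
unshelve eexists (prod_cat C D) (prod_fun (iJ C) (iJ D)) _.
- unshelve eexists.
  + unshelve eexists.
    { exact (fun p : prod_cat C D => (ij C (fst p), ij D (snd p))). }
    abstract (intros p q f; exact (f_equal2 pair (nat_natural (ij C) (fst f))
                                                 (nat_natural (ij D) (snd f)))).
  + exact (fun p => (iso_inv (ij C) (fst p), iso_inv (ij D) (snd p))).
  + abstract (intros p; exact (f_equal2 pair (iso_inv_l (ij C) (fst p))
                                             (iso_inv_l (ij D) (snd p)))).
  + abstract (intros p; exact (f_equal2 pair (iso_inv_r (ij C) (fst p))
                                             (iso_inv_r (ij D) (snd p)))).
- abstract (intros p; exact (f_equal2 pair (ij_J (fst p)) (ij_J (snd p)))).
Defined.

Definition prod_ifun (C C' D D' : ICategory) (F : IFunctor C C') (G : IFunctor D D') :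
  IFunctor (prod_icat C D) (prod_icat C' D').
Proof.
unshelve eexists (prod_fun F G) _.
- unshelve eexists.
  { exact (fun p : prod_cat C D => (inu F (fst p), inu G (snd p))). }
  abstract (intros p q f; exact (f_equal2 pair (nat_natural (inu F) (fst f))
                                               (nat_natural (inu G) (snd f)))).
- abstract (intros p; exact (f_equal2 pair (inu_ij F (fst p)) (inu_ij G (snd p)))).
Defined.

Definition prod_inat (C C' D D' : ICategory) (F F' : IFunctor C C') (G G' : IFunctor D D')
  (a : INat F F') (b : INat G G') : INat (prod_ifun F G) (prod_ifun F' G').
Proof.
exists (prod_nat a b).
abstract (intros p; exact (f_equal2 pair (inat_inu a (fst p)) (inat_inu b (snd p)))).
Defined.

(* (-) × D: the second entry is fixed, with identity 1- and 2-cells. *)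
Definition prod_tf (D : ICategory) : TwoFunctor ICat ICat.
Proof.
unshelve eexists (fun C : ICat => prod_icat C D : ICat) _.
- intros C C'.
  exists (fun F : icat_hom C C' =>
            prod_ifun F (id_ifun D) : icat_hom (prod_icat C D) (prod_icat C' D))
         (fun F F' (a : INat F F') => prod_inat a (inat_id (id_ifun D))).
  + abstract (intros; apply inat_ext; reflexivity).
  + abstract (intros; apply inat_ext; intros; cbn; rewrite comp_id_l; reflexivity).
- abstract (intros C; apply ifunctor_ext;
            [intros [] | intros [] [] [] | intros []]; reflexivity).
- abstract (intros; apply icat_functor_ext; [intros; apply ifunctor_ext |];
            intros; cbn; rewrite ?comp_id_l; reflexivity).
Defined.

Definition exp_fun (C C' D D' : Category) (F : Functor C C') (G : Functor D' D) :
  Functor (fun_cat D C) (fun_cat D' C').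
Proof.
unshelve eexists (fun X : fun_cat D C => F ∘F X ∘F G : fun_cat D' C') _.
- intros X Y a; exists (fun d => fmap F (a (G d))).
  abstract (intros; cbn; rewrite <- !fmap_comp, nat_natural; reflexivity).
- abstract (intros; apply nat_ext; intros; cbn; apply fmap_id).
- abstract (intros; apply nat_ext; intros; cbn; apply fmap_comp).
Defined.

(* The component at d of the component at X of ζ^ξ.  Strictly equal composites
   of functors, such as (FX)G and F(XG), need not be convertible, whereas their
   values are; so the families j^k and ν^(χ⁻¹) below are given by this formula
   at each d instead of by transporting [exp_nat]. *)
Definition exp_nat_comp (C C' D D' : Category) (F F' : Functor C C')
  (G G' : Functor D' D) (a : Nat F F') (b : Nat G G') (X : Functor D C) (d : D') :
  hom (F (X (G d))) (F' (X (G' d))) :=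
  fmap F' (fmap X (b d)) ∘ a (X (G d)).

Lemma exp_nat_compE (C C' D D' : Category) (F F' : Functor C C')
  (G G' : Functor D' D) (a : Nat F F') (b : Nat G G') (X : Functor D C) (d : D') :
  exp_nat_comp a b X d = a (X (G' d)) ∘ fmap F (fmap X (b d)).
Proof. unfold exp_nat_comp; rewrite nat_natural; reflexivity. Qed.

Lemma exp_nat_comp_natural (C C' D D' : Category) (F F' : Functor C C')
  (G G' : Functor D' D) (a : Nat F F') (b : Nat G G') (X : Functor D C)
  (d e : D') (f : hom d e) :
  exp_nat_comp a b X e ∘ fmap F (fmap X (fmap G f))
  = fmap F' (fmap X (fmap G' f)) ∘ exp_nat_comp a b X d.
Proof.
unfold exp_nat_comp.
rewrite comp_assoc, nat_natural, <- !comp_assoc, <- !fmap_comp, nat_natural.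
reflexivity.
Qed.

Lemma exp_nat_comp_fun (C C' D D' : Category) (F F' : Functor C C')
  (G G' : Functor D' D) (a : Nat F F') (b : Nat G G') (X Y : Functor D C)
  (c : Nat X Y) (d : D') :
  exp_nat_comp a b Y d ∘ fmap F (c (G d)) = fmap F' (c (G' d)) ∘ exp_nat_comp a b X d.
Proof.
unfold exp_nat_comp.
rewrite comp_assoc, nat_natural, <- !comp_assoc, <- !fmap_comp, nat_natural.
reflexivity.
Qed.

Definition exp_nat (C C' D D' : Category) (F F' : Functor C C')
  (G G' : Functor D' D) (a : Nat F F') (b : Nat G G') : Nat (exp_fun F G) (exp_fun F' G').
Proof.
unshelve eexists.
- intros X; exists (exp_nat_comp a b X).
  abstract (intros; apply exp_nat_comp_natural).
- abstract (intros X Y c; apply nat_ext; intros d; apply (exp_nat_comp_fun a b c)).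
Defined.

Definition exp_ij (C D : ICategory) :
  NatIso (id_fun (fun_cat D C)) (exp_fun (iJ C) (iJ D) ∘F exp_fun (iJ C) (iJ D)).
Proof.
unshelve eexists.
- unshelve eexists.
  + intros X; exists (exp_nat_comp (ij C) (ij D) X).
    abstract (intros; apply (exp_nat_comp_natural (ij C) (ij D))).
  + abstract (intros X Y c; apply nat_ext; intros d;
              apply (exp_nat_comp_fun (ij C) (ij D) c)).
- intros X.
  exists (fun d => iso_inv (ij C) (X d)
                     ∘ fmap (iJ C) (fmap (iJ C) (fmap X (iso_inv (ij D) d)))).
  abstract (intros d e f; cbn; rewrite comp_assoc, <- !fmap_comp;
            rw (iso_inv_natural (ij D) f); rewrite !fmap_comp, <- !comp_assoc;
            rw (iso_inv_natural (ij C) (fmap X f)); reflexivity).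
- abstract (intros X; apply nat_ext; intros d; cbn; unfold exp_nat_comp; cbn;
            rewrite comp_assoc, <- (comp_assoc (fmap (iJ C) _)), <- !fmap_comp;
            rw (iso_inv_l (ij D) d); rewrite !fmap_id, comp_id_l;
            apply (iso_inv_l (ij C))).
- abstract (intros X; apply nat_ext; intros d; cbn; unfold exp_nat_comp; cbn;
            rewrite comp_assoc; rw (comp_cancel (iso_inv_r (ij C) (X d)));
            rewrite <- !fmap_comp; rw (iso_inv_r (ij D) d);
            rewrite !fmap_id; reflexivity).
Defined.

(* [exp_icat C D] is C^D. *)
Definition exp_icat (C D : ICategory) : ICategory.
Proof.
exists (fun_cat D C) (exp_fun (iJ C) (iJ D)) (exp_ij C D).
abstract (intros X; apply nat_ext; intros d; cbn; unfold exp_nat_comp; cbn;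
          rewrite fmap_comp; rw (ij_J d); rw (ij_J (X (iJ D d))); reflexivity).
Defined.

Definition exp_ifun (C C' D D' : ICategory) (F : IFunctor C C') (G : IFunctor D' D) :
  IFunctor (exp_icat C D) (exp_icat C' D').
Proof.
unshelve eexists (exp_fun F G) _.
- unshelve eexists.
  + intros X; exists (exp_nat_comp (inu F) (inu_inv G) X).
    abstract (intros; apply (exp_nat_comp_natural (inu F) (inu_inv G))).
  + abstract (intros X Y c; apply nat_ext; intros d;
              apply (exp_nat_comp_fun (inu F) (inu_inv G) c)).
- abstract (intros X; apply nat_ext; intros d; cbn; unfold exp_nat_comp; cbn;
    rewrite !fmap_comp, !comp_assoc;
    rw (comp_square (nat_natural (inu F) (fmap (iJ C) (fmap X (ij D (G d))))));
    rw (comp_square (fmap_square (iJ C') (nat_natural (inu F)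
          (fmap X (fmap (iJ D) (inu_inv G d))))));
    rw (comp_square (fmap_square (iJ C') (nat_natural (inu F)
          (fmap X (ij D (G d))))));
    rw (eq_trans (eq_sym (comp_assoc _ _ _)) (inu_ij F (X (G d))));
    rewrite <- !comp_assoc, <- !fmap_comp, !comp_assoc;
    rw (inu_inv_ij G d); reflexivity).
Defined.

Definition exp_inat (C C' D D' : ICategory) (F F' : IFunctor C C')
  (G G' : IFunctor D' D) (a : INat F F') (b : INat G G') :
  INat (exp_ifun F G) (exp_ifun F' G').
Proof.
exists (exp_nat a b).
abstract (intros X; apply nat_ext; intros d; cbn; unfold exp_nat_comp; cbn;
  rewrite !fmap_comp, !comp_assoc;
  rw (comp_square (fmap_square (iJ C') (nat_natural a (fmap X (inu_inv G d)))));
  rwb (inat_inu a (X (iJ D (G d))));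
  rw (comp_square (nat_natural (inu F') (fmap X (fmap (iJ D) (b d)))));
  rewrite <- !comp_assoc, <- !fmap_comp;
  rw (inat_inu_inv b d); reflexivity).
Defined.

(* (-)^D: the exponent is fixed, with identity 1- and 2-cells. *)
Definition exp_tf (D : ICategory) : TwoFunctor ICat ICat.
Proof.
unshelve eexists (fun C : ICat => exp_icat C D : ICat) _.
- intros C C'.
  exists (fun F : icat_hom C C' =>
            exp_ifun F (id_ifun D) : icat_hom (exp_icat C D) (exp_icat C' D))
         (fun F F' (a : INat F F') => exp_inat a (inat_id (id_ifun D))).
  + abstract (intros; apply inat_ext; intros X; apply nat_ext; intros d; cbn;
              unfold exp_nat_comp; cbn; rewrite !fmap_id, comp_id_l; reflexivity).
  + abstract (intros; apply inat_ext; intros X; apply nat_ext; intros d; cbn;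
              unfold exp_nat_comp; cbn; rewrite !fmap_id, !comp_id_l; reflexivity).
- abstract (intros C; apply ifunctor_ext; intros;
            [| apply nat_JMeq .. ]; try (apply functor_ext; reflexivity);
            intros d; cbn; unfold exp_nat_comp; cbn;
            rewrite ?comp_id_r; try rw (inu_inv_id d); rewrite ?fmap_id;
            reflexivity).
- abstract (intros A B C; apply icat_functor_ext;
            [intros; apply ifunctor_ext; intros; [| apply nat_JMeq ..]
            | intros; apply nat_JMeq];
            try (apply functor_ext; reflexivity);
            intros d; cbn; unfold exp_nat_comp; cbn; try rw (inu_inv_id d);
            rewrite ?fmap_id, ?comp_id_l; reflexivity).
Defined.

(* Main.v *)
Require Import Defs.

(* The 2-adjunction of categories is currying, with unit c ↦ (d ↦ (c, d)) and
   counit the evaluation (X, d) ↦ X d.  Both become involutive with ν built from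
   k alone: the unit compares (J c, d) with (J c, K K d) through k_d, the counit
   compares J X K K d with J X d through J X (k_d)⁻¹.  The triangle identities
   then hold because these two copies of k cancel, using K k = k K. *)

Set Implicit Arguments.
Unset Strict Implicit.
Local Open Scope cat_scope.

Definition pairing_fun (C D : Category) (c : C) : Functor D (prod_cat C D) :=
  pair_fun (const_fun D c) (id_fun D).

Definition coev_fun (C D : Category) : Functor C (fun_cat D (prod_cat C D)).
Proof.
unshelve eexists (fun c => pairing_fun D c : fun_cat D (prod_cat C D)) _.
- intros c c' f.
  exists (fun d => (f, idm d) : hom (pairing_fun D c d) (pairing_fun D c' d)).
  abstract (intros; cbn; rewrite !comp_id_l, !comp_id_r; reflexivity).
- abstract (intros; apply nat_ext; reflexivity).
- abstract (intros; apply nat_ext; intros; cbn; rewrite comp_id_l; reflexivity).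
Defined.

Definition coev_ifun (D C : ICategory) : IFunctor C (exp_icat (prod_icat C D) D).
Proof.
unshelve eexists (coev_fun C D) _.
- unshelve eexists.
  + intros c.
    exists (fun d => (idm (iJ C c), ij D d)
      : hom (pairing_fun D (iJ C c) d)
            ((iJ (prod_icat C D) ∘F pairing_fun D c ∘F iJ D) d)).
    abstract (intros d e f; cbn; rewrite fmap_id, !comp_id_l;
              exact (f_equal (pair _) (nat_natural (ij D) f))).
  + abstract (intros c c' f; apply nat_ext; intros d; cbn;
              rewrite fmap_id, !comp_id_l, !comp_id_r; reflexivity).
(* In the second coordinate the sides are K(k_{Kd}) ∘ k_d and K K(k_d) ∘ k_d, equal by k_{Kd} =
   K(k_d). *)
- abstract (intros c; apply nat_ext; intros d; cbn; unfold exp_nat_comp; cbn;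
            rewrite !fmap_id, !comp_id_l, comp_id_r; rw (ij_J d); reflexivity).
Defined.

Definition eval_fun (D C : Category) : Functor (prod_cat (fun_cat D C) D) C.
Proof.
exists (fun p : prod_cat (fun_cat D C) D => (fst p : Functor D C) (snd p))
       (fun p q f => (fst f : Nat _ _) (snd q) ∘ fmap (fst p : Functor D C) (snd f)).
- abstract (intros; cbn; rewrite fmap_id, comp_id_l; reflexivity).
- abstract (intros p q r g f; cbn;
            rewrite fmap_comp, !comp_assoc, (comp_square (nat_natural (fst f) _));
            reflexivity).
Defined.

Definition eval_ifun (D C : ICategory) : IFunctor (prod_icat (exp_icat C D) D) C.
Proof.
unshelve eexists (eval_fun D C) _.
- unshelve eexists.
  + exact (fun p => fmap (iJ C) (fmap (fst p : Functor D C) (iso_inv (ij D) (snd p)))).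
  + abstract (intros p q f; cbn; rewrite <- !fmap_comp; f_equal;
              rewrite !comp_assoc;
              rwb (comp_square (nat_natural (fst f : Nat _ _) (iso_inv (ij D) (snd q))));
              rewrite <- !fmap_comp; rw (iso_inv_natural (ij D) (snd f)); reflexivity).
(* As k_{KKd} = K(k_{Kd}), the factor of j^k at KKd cancels the inner ν; naturality of j along
   X(k_d) then lets the outer ν cancel too. *)
- abstract (intros [X d]; cbn; unfold exp_nat_comp; cbn;
            rw (ij_J (iJ D d)); rewrite !comp_assoc;
            rw (comp_square (fmap_square (iJ C) (fmap_square (iJ C)
                 (* Writing k⁻¹ ∘ k as id ∘ id makes the cancellation a square that functors
                    preserve. *)
                 (fmap_square X (fmap_square (iJ D)
                   (eq_trans (iso_inv_l (ij D) (iJ D d))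
                             (eq_sym (comp_id_l (idm _)))))))));
            rewrite !fmap_id, !comp_id_l;
            rw (nat_natural (ij C) (fmap X (ij D d)));
            rewrite <- comp_assoc, <- !fmap_comp; rw (iso_inv_l (ij D) d);
            rewrite !fmap_id, comp_id_l; reflexivity).
Defined.

Definition coev_tn (D : ICategory) :
  TwoNat (id_tf ICat) (comp_tf (exp_tf D) (prod_tf D)).
Proof.
exists (fun C : ICat => coev_ifun D C : Hom (t := ICat) _ _).
abstract (intros A B; apply icat_functor_ext;
          [intros; apply ifunctor_ext; intros; [| apply nat_JMeq ..]
          | intros; apply nat_JMeq];
          try (apply functor_ext; intros; cbn; rewrite ?fmap_id; reflexivity);
          intros d; cbn; unfold exp_nat_comp; cbn;
          (* The exponent contributes the inverse comparison of Id, a formula in k that equals the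
             identity only by a lemma. *)
          try rw (inu_inv_id d); rewrite ?fmap_id, ?comp_id_l, ?comp_id_r;
          reflexivity).
Defined.

Definition eval_tn (D : ICategory) :
  TwoNat (comp_tf (prod_tf D) (exp_tf D)) (id_tf ICat).
Proof.
exists (fun C : ICat => eval_ifun D C : Hom (t := ICat) _ _).
intros A B; apply icat_functor_ext; [intros F; apply ifunctor_ext |];
  intros; cbn; unfold exp_nat_comp; cbn;
  rewrite ?fmap_id, ?fmap_comp, ?comp_id_l, ?comp_id_r; try reflexivity.
(* Only the comparison cells remain; they agree by naturality of the ν of [F] along X(k_d⁻¹). *)
rw (inu_inv_id (C := D) (iJ D (snd x))); rewrite !fmap_id, comp_id_l.
rw (nat_natural (inu F) (fmap (fst x : Functor _ _) (iso_inv (ij D) (snd x)))).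
reflexivity.
Defined.

Theorem proposition4p3 :
  forall D : ICategory, inhabited (TwoAdjunction (prod_tf D) (exp_tf D)).
Proof.
intros D; constructor; exists (coev_tn D) (eval_tn D).
- intros C; apply ifunctor_ext.
  + intros []; reflexivity.
  + intros [] [] []; cbn; rewrite comp_id_l, comp_id_r; reflexivity.
  (* The second coordinate of ν is K(k_d⁻¹) ∘ k_{Kd}. *)
  + intros [c d]; cbn; rewrite fmap_id, !comp_id_l, comp_id_r.
    rw (ij_J d); rewrite <- fmap_comp; rw (iso_inv_l (ij D) d).
    rewrite fmap_id; reflexivity.
(* Evaluation after pairing with X sends f to id ∘ X f, so it is equal to X but not convertible to
   it; hence [JMeq]. *)
- intros C; apply ifunctor_ext; intros; [| apply nat_JMeq ..];
    try (apply functor_ext; intros); cbn; unfold exp_nat_comp; cbn;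
    rewrite ?comp_id_l; try reflexivity.
  + intros d; rewrite fmap_id, comp_id_r; reflexivity.
  (* Here ν is J X(k_{Kd}⁻¹) ∘ J X K(k_d), so K(k_d) is turned back into k_{Kd}. *)
  + intros d; rw (inu_inv_id d); rewrite comp_id_l, !fmap_id, !comp_id_l.
    rwb (ij_J d); rewrite <- !fmap_comp; rw (iso_inv_l (ij D) (iJ D d)).
    rewrite !fmap_id; reflexivity.
Qed.
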